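(* Let $J$ be the $N\times N$ complex Jacobi matrix with entries $a_0,\dots,a_{N-2}\in\mathbb{C}\setminus\{0\}$, $b_0,\dots,b_{N-1}\in\mathbb{C}$, and let $P_0(\lambda),\dots,P_N(\lambda)$ be the associated polynomials defined in the context. There exists a unique linear functional $\Omega:\mathbb{C}_{2N}[\lambda]\to\mathbb{C}$ such that $$\langle\Omega,P_m(\lambda)P_n(\lambda)\rangle=\delta_{mn},\qquad m,n\in\{0,1,\dots,N-1\},$$ $$\langle\Omega,P_m(\lambda)P_N(\lambda)\rangle=0,\qquad m\in\{0,1,\dots,N\},$$ where $\delta_{mn}$ is the Kronecker delta.
   Context: $N$ is a positive integer. $J$ is the $N\times N$ symmetric tridiagonal matrix (rows and columns indexed $0,\dots,N-1$) with diagonal entries $b_0,\dots,b_{N-1}$, with entries $a_n$ in positions $(n,n+1)$ and $(n+1,n)$ for $0\le n\le N-2$, and zeros elsewhere. Put $a_{N-1}=1$. The polynomials $P_0(\lambda),\dots,P_N(\lambda)$ are defined by $P_0(\lambda)=1$ and the recursion $b_0P_0(\lambda)+a_0P_1(\lambda)=\lambda P_0(\lambda)$, $a_{n-1}P_{n-1}(\lambda)+b_nP_n(\lambda)+a_nP_{n+1}(\lambda)=\lambda P_n(\lambda)$ for $n\in\{1,\dots,N-1\}$. $\mathbb{C}_m[\lambda]$ is the space of polynomials in $\lambda$ of degree $\le m$ with complex coefficients; $\langle\Omega,G(\lambda)\rangle$ denotes the value of the ($\mathbb{C}$-)linear functional $\Omega$ at $G$. *)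

(* Defs.v *)
From HB Require Import structures.
From mathcomp Require Import all_boot all_order all_algebra.
From mathcomp Require Import reals complex.

Set Implicit Arguments.
Unset Strict Implicit.
Unset Printing Implicit Defensive.
Import GRing.Theory.
Local Open Scope ring_scope.

Section Jacobi.
Variable F : fieldType.

(* The sequences a, b are indexed by nat; only a_0, ..., a_{N-2} and
   b_0, ..., b_{N-1} enter the matrix. *)
Definition jacobi_mx (N : nat) (a b : nat -> F) : 'M[F]_N :=
  \matrix_(i < N, j < N)
    (if i == j :> nat then b i
     else if j == i.+1 :> nat then a i
     else if i == j.+1 :> nat then a j
     else 0).

(* Only P_0, ..., P_N are constrained; the last equation involves a_{N-1},
   which is not a matrix entry and is to be normalised to 1 by the user. *)
Definition jacobi_polys (N : nat) (a b : nat -> F) (P : nat -> {poly F}) :=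
  [/\ P 0 = 1,
      b 0 *: P 0 + a 0 *: P 1 = 'X * P 0
    & forall n, (1 <= n <= N.-1)%N ->
        a n.-1 *: P n.-1 + b n *: P n + a n *: P n.+1 = 'X * P n].

(* {poly_d.+1 F} is the space of polynomials of degree <= d. *)
Definition poly_functional (d : nat) := 'Hom({poly_d.+1 F}, F^o).

(* npolyp d.+1 G is G itself, seen in {poly_d.+1 F}, when deg G <= d (npolypK);
   by size_jacobi_polysM this is the case of P_m P_n for m, n <= N and d = 2N. *)
Definition pairing (d : nat) (Omega : poly_functional d) (G : {poly F}) : F :=
  Omega (npolyp d.+1 G).

Lemma size_jacobi_polys N (a b : nat -> F) P :
  (forall n, (n <= N.-1)%N -> a n != 0) -> (0 < N)%N -> jacobi_polys N a b P ->
  forall n, (n <= N)%N -> size (P n) = n.+1.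
Proof.
move=> a0 N0 [P0 P1 Prec].
suff H n : (n.+1 <= N)%N -> size (P n) = n.+1 /\ size (P n.+1) = n.+2.
  by case=> [_|n /H[]//]; rewrite P0 size_poly1.
elim: n => [_|n IHn ltnN].
  split; first by rewrite P0 size_poly1.
  rewrite -(size_scale _ (a0 0 (leq0n _))).
  have -> : a 0 *: P 1 = 'X * P 0 - b 0 *: P 0 by rewrite -P1 addrC addKr.
  by rewrite P0 mulr1 alg_polyC size_XsubC.
have [sn sn1] := IHn (ltnW ltnN); split=> //.
have len : (n.+1 <= N.-1)%N by rewrite -ltnS prednK.
rewrite -(size_scale _ (a0 _ len)).
have /= E := Prec n.+1 len.
have -> : a n.+1 *: P n.+2 = 'X * P n.+1 - (a n *: P n + b n.+1 *: P n.+1).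
  by rewrite -E addrC addKr.
have sX : size ('X * P n.+1) = n.+3.
  by rewrite mulrC size_mulX ?sn1 // -size_poly_eq0 sn1.
rewrite size_polyDl sX // size_polyN.
apply: leq_ltn_trans (size_polyD _ _) _; rewrite gtn_max.
rewrite (leq_ltn_trans (size_scale_leq _ _)) ?sn //.
by rewrite (leq_ltn_trans (size_scale_leq _ _)) ?sn1.
Qed.

Lemma size_jacobi_polysM N (a b : nat -> F) P :
  (forall n, (n <= N.-1)%N -> a n != 0) -> (0 < N)%N -> jacobi_polys N a b P ->
  forall m n, (m <= N)%N -> (n <= N)%N ->
  (size (P m * P n)%R <= (2 * N).+1)%N.
Proof.
move=> a0 N0 JP m n lemN lenN; apply: leq_trans (size_polyMleq _ _) _.
rewrite !(size_jacobi_polys a0 N0 JP) // addSn /= addnS ltnS mul2n -addnn.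
exact: leq_add.
Qed.

Lemma jacobi_polys_exists N (a b : nat -> F) :
  (forall n, (n <= N.-1)%N -> a n != 0) -> exists P, jacobi_polys N a b P.
Proof.
move=> a0.
pose step n (pq : {poly F} * {poly F}) :=
  (pq.2, (a n.+1)^-1 *: ('X * pq.2 - (a n *: pq.1 + b n.+1 *: pq.2))).
pose Q n := iteri n step (1, (a 0)^-1 *: ('X - (b 0)%:P)).
exists (fun n => (Q n).1); split=> //= [|[//|n]] /=.
  by rewrite scalerA mulfV ?a0 // scale1r mulr1 alg_polyC addrC subrK.
by move=> len; rewrite scalerA mulfV ?a0 // scale1r addrC subrK.
Qed.

End Jacobi.

(* Main.v *)
(** Over any field, [G |-> (G(J))_00] is the required functional: the
    recursion gives [e_0 P_k(J) = e_k] for [k < N] and [e_0 P_N(J) = 0], and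
    [J] is symmetric, so [(P_m(J) P_n(J))_00 = <e_m, e_n>].  Uniqueness holds
    because the products [P_k P_k] and [P_k P_(k+1)] contain one polynomial of
    each degree [0, ..., 2N]. *)
Require Import Defs.
From HB Require Import structures.
From mathcomp Require Import all_boot all_order all_algebra.
From mathcomp Require Import reals complex.

Set Implicit Arguments.
Unset Strict Implicit.
Unset Printing Implicit Defensive.
Import GRing.Theory.
Local Open Scope ring_scope.

(** A family with one polynomial of each degree below [d] spans the space: induct on a bound for the
    size of [p], lowering it by subtracting a multiple of the member that has the same leading
    degree. *)
Lemma npoly_hom_eq (F : fieldType) (V : vectType F) d
    (f g : 'Hom({poly_d F}, V)) (Q : nat -> {poly F}) :
  (forall k, (k < d)%N -> size (Q k) = k.+1) ->
  (forall k, (k < d)%N -> f (npolyp d (Q k)) = g (npolyp d (Q k))) ->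
  f = g.
Proof.
move=> sizeQ fgQ; apply/lfunP.
suff fg m (p : {poly_d F}) : (size p <= m)%N -> f p = g p.
  by move=> p; apply: (fg _ _ (leqnn _)).
elim: m p => [|m IHm] p.
  rewrite leqn0 size_poly_eq0 => /eqP p0.
  by have -> : p = 0 by [apply: val_inj]; rewrite !linear0.
have [ltmd lepm|ledm _] := ltnP m d; last first.
  by apply: IHm; apply: leq_trans (size_npoly p) ledm.
(* Chosen so that [p - c *: Q m] has no coefficient in degree [m]. *)
pose c := p`_m / lead_coef (Q m).
have Qm : npolyp d (Q m) = Q m :> {poly F} by rewrite npolypK ?sizeQ.
have Qm_neq0 : lead_coef (Q m) != 0.
  by rewrite lead_coef_eq0 -size_poly_eq0 sizeQ.
have : (size (p - c *: npolyp d (Q m))%R <= m)%N.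
  apply/leq_sizeP => j; rewrite leq_eqVlt /= Qm coefB coefZ => /predU1P[<-|ltmj].
    have -> : (Q m)`_m = lead_coef (Q m) by rewrite lead_coefE sizeQ.
    by rewrite divfK ?subrr.
  by rewrite !nth_default ?sizeQ ?mulr0 ?subr0 // (leq_trans lepm).
by move=> /IHm; rewrite !linearB !linearZ /= fgQ // => /addIr.
Qed.

Section VacuumState.
Variables (F : fieldType) (n : nat) (J : 'M[F]_n.+1) (d : nat).

Definition vacuum_state (p : {poly_d F}) : F^o := horner_mx J p 0 0.

Lemma vacuum_state_linear : linear vacuum_state.
Proof. by move=> c p q; rewrite /vacuum_state linearP !mxE. Qed.

HB.instance Definition _ :=
  GRing.isLinear.Build F {poly_d F} F^o _ vacuum_state vacuum_state_linear.

End VacuumState.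

(** Transposition reverses products, which is harmless here because [A] commutes with every
    polynomial in [A]. *)
Lemma horner_mx_tr (F : fieldType) n (A : 'M[F]_n.+1) p :
  horner_mx A^T p = (horner_mx A p)^T.
Proof.
elim/poly_ind: p => [|p c IHp]; first by rewrite !rmorph0 trmx0.
rewrite !rmorphD !rmorphM /= !horner_mx_X !horner_mx_C IHp linearD /=.
rewrite tr_scalar_mx; congr (_ + _); rewrite -[LHS]trmx_mul.
by congr trmx; apply: comm_mx_horner.
Qed.

Lemma tr_jacobi_mx (F : fieldType) N (a b : nat -> F) :
  (jacobi_mx N a b)^T = jacobi_mx N a b.
Proof.
apply/matrixP=> i j; rewrite !mxE eq_sym.
case: eqP => [->//|_]; case: eqP => // E; case: eqP => // E'.
by move/eqP: E'; rewrite E ltn_eqF // ltnW.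
Qed.

(* [unit_row F n n] is [0]: the case [k = N] of [e_0 P_k(J) = e_k]. *)
Definition unit_row (F : fieldType) n k : 'rV[F]_n :=
  \row_j (k == j :> nat)%:R.

(** The unit rows obey the same three-term recursion as the [P k], with [J] in place of ['X]. The
    last row of [J] is no exception, since [unit_row F N N] is 0. *)
Lemma unit_row_jacobi_mx (F : fieldType) N (a b : nat -> F) k : (k < N)%N ->
  unit_row F N k *m jacobi_mx N a b =
  (if k is k'.+1 then a k' *: unit_row F N k' else 0)
  + b k *: unit_row F N k + a k *: unit_row F N k.+1.
Proof.
move=> ltkN.
have -> : unit_row F N k = delta_mx 0 (Ordinal ltkN).
  by apply/rowP=> j; rewrite !mxE /= eq_sym.
rewrite -rowE; apply/rowP=> j; rewrite !mxE /=.
rewrite -val_eqE /= [j == k :> nat]eq_sym.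
have -> : (if k is k'.+1 then a k' *: unit_row F N k' else 0) 0 j
          = if k == j.+1 then a j else 0.
  case: k {ltkN} => [|k]; rewrite !mxE // eqSS.
  by case: eqP => [->|_]; rewrite ?mulr1 ?mulr0.
have [<-|neq_kj] := eqVneq k j; first by rewrite ltn_eqF // gtn_eqF // mulr1 mulr0 add0r addr0.
rewrite [j == _ :> nat]eq_sym mulr0 addr0.
have [<-|_] := eqVneq k.+1 j; last by rewrite mulr0 addr0.
by rewrite ltn_eqF ?add0r ?mulr1.
Qed.

Lemma unit_row_jacobi_polys (F : fieldType) n (a b : nat -> F) P :
  (forall k, (k <= n)%N -> a k != 0) -> jacobi_polys n.+1 a b P ->
  forall k, (k <= n.+1)%N ->
  unit_row F n.+1 0 *m horner_mx (jacobi_mx n.+1 a b) (P k) = unit_row F n.+1 k.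
Proof.
move=> a_neq0 [P0 P1 Prec].
set J := jacobi_mx _ _ _; set e := unit_row F n.+1.
have act_X p : e 0 *m horner_mx J ('X * p) = e 0 *m horner_mx J p *m J.
  by rewrite mulrC rmorphM /= horner_mx_X mulmxA.
have e0 : e 0 *m horner_mx J (P 0) = e 0 by rewrite P0 rmorph1 mulmx1.
(* The recursion has order two, so the induction carries two consecutive indices. At each step the
   lower terms cancel and [a k] is divided out. *)
suff e_next k : (k <= n)%N -> e 0 *m horner_mx J (P k) = e k /\
                             e 0 *m horner_mx J (P k.+1) = e k.+1.
  by case=> // k /e_next[].
elim: k => [_|k IHk ltkn].
  split=> //; apply: (scalerI (a_neq0 0 isT)).
  have /(congr1 (fun p => e 0 *m horner_mx J p)) := P1.
  rewrite act_X e0 unit_row_jacobi_mx // add0r linearD !linearZ /= mulmxDr.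
  by rewrite -!scalemxAr e0 => /addrI.
have [ek ek1] := IHk (ltnW ltkn); split=> //.
apply: (scalerI (a_neq0 _ ltkn)).
have /(congr1 (fun p => e 0 *m horner_mx J p)) := Prec k.+1 ltkn.
rewrite act_X ek1 unit_row_jacobi_mx // !linearD !linearZ /=.
by rewrite ek ek1 => /addrI.
Qed.

Lemma vacuum_state_jacobi_polysM (F : fieldType) n (a b : nat -> F) P k l :
  (forall k, (k <= n)%N -> a k != 0) -> jacobi_polys n.+1 a b P ->
  (k <= n.+1)%N -> (l <= n.+1)%N ->
  pairing (linfun (vacuum_state (jacobi_mx n.+1 a b) (d := (2 * n.+1).+1)))
    (P k * P l) = ((k == l) && (l < n.+1)%N)%:R.
Proof.
move=> a_neq0 JP lek lel.
rewrite /pairing lfunE /= /vacuum_state npolypK; last first.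
  exact: (size_jacobi_polysM (N := n.+1) a_neq0 _ JP).
set J := jacobi_mx _ _ _.
have e0E : unit_row F n.+1 0 = delta_mx 0 0.
  by apply/rowP=> j; rewrite !mxE /= -val_eqE eq_sym.
have row0 i : (i <= n.+1)%N -> row 0 (horner_mx J (P i)) = unit_row F n.+1 i.
  by move=> lei; rewrite rowE -e0E unit_row_jacobi_polys.
(* By symmetry of [J], column 0 of the second factor is its row 0 transposed, so the entry is a dot
   product of two unit rows. *)
rewrite rmorphM /= -[J in horner_mx J (P l)]tr_jacobi_mx horner_mx_tr.
have -> : (horner_mx J (P k) * (horner_mx J (P l))^T) 0 0
        = (unit_row F n.+1 k *m (unit_row F n.+1 l)^T) 0 0.
  by rewrite -!row0 // !mxE; apply: eq_bigr => i _; rewrite !mxE.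
rewrite !mxE; have [ltl|gel] := ltnP l n.+1.
  rewrite (bigD1 (Ordinal ltl)) //= !mxE /= eqxx mulr1 andbT.
  rewrite big1 ?addr0 // => i neq_il; rewrite !mxE.
  by rewrite [l == _]eq_sym [_ == l](negPf neq_il) mulr0.
rewrite andbF big1 // => i _; rewrite !mxE.
by rewrite [l == _]gtn_eqF ?mulr0 // (leq_trans (ltn_ord i)).
Qed.

Theorem theorem1 (R : realType) (N : nat) (a b : nat -> R[i])
    (J : 'M[R[i]]_N) (P : nat -> {poly R[i]})
    (N_gt0 : (0 < N)%N)
    (a_neq0 : forall n : nat, (n.+1 < N)%N -> a n != 0)
    (J_def : J = jacobi_mx N a b)
    (a_last : a N.-1 = 1)
    (P_def : jacobi_polys N a b P) :
  exists! Omega : poly_functional R[i] (2 * N),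
    (forall m n : nat, (m < N)%N -> (n < N)%N ->
       pairing Omega (P m * P n) = (m == n)%:R) /\
    (forall m : nat, (m <= N)%N -> pairing Omega (P m * P N) = 0).
Proof.
case: N => [//|N] in J N_gt0 a_neq0 J_def a_last P_def *.
(* The normalisation of the last [a] supplies the case [k = N]. *)
have a_nz k : (k <= N)%N -> a k != 0.
  by rewrite leq_eqVlt => /predU1P[->|/a_neq0//]; rewrite a_last oner_neq0.
have szP := size_jacobi_polys (N := N.+1) a_nz N_gt0 P_def.
exists (linfun (vacuum_state (jacobi_mx N.+1 a b) (d := (2 * N.+1).+1))).
split.
  split=> [m n ltm ltn|m lem]; last first.
    by rewrite vacuum_state_jacobi_polysM // ltnn andbF.
  by rewrite vacuum_state_jacobi_polysM ?ltn ?andbT // ltnW.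
move=> Omega [OmegaP OmegaPN].
(* The two halves sum to [k] and differ by at most one, so [P k./2 * P (uphalf k)] has degree
   [k]. *)
have half_le k : (k < (2 * N.+1).+1)%N -> (k./2 <= uphalf k <= N.+1)%N.
  by rewrite ltnS mul2n leq_uphalf_double uphalf_half leq_addl.
apply: (npoly_hom_eq (Q := fun k => P k./2 * P (uphalf k))) => k /half_le.
  case/andP=> leh leu; have {}leh := leq_trans leh leu.
  rewrite size_proper_mul ?szP ?mulf_neq0 ?lead_coef_eq0 -?size_poly_eq0 ?szP //.
  by rewrite addnS addSn /= uphalf_half addnCA addnn odd_double_half.
case/andP=> leh leu; rewrite -![_ (npolyp _ _)]/(pairing _ _).
rewrite vacuum_state_jacobi_polysM ?(leq_trans leh leu) //.
(* The larger index reaches [N.+1] only for the top two degrees; there the second condition on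
   [Omega] applies, elsewhere the first. *)
move: leu; rewrite leq_eqVlt => /predU1P[eu|ltu].
  by rewrite eu ltnn andbF OmegaPN // -eu.
by rewrite ltu andbT OmegaP // (leq_ltn_trans leh).
Qed.
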